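(* Suppose $C_0(\Sigma)=[\xi,\eta]$ and $a>\eta$. Let $n\ge1$ and, for $N\ge0$, let $x_{n,n}^N=x_{n,n}^N(a)$ be the largest zero of $p_n^N(a;x)$. Put $$N_0=N_0(n,a,\eta)=\frac{-p_n(\eta)}{K_{n-1}(a,a)\,(\eta-a)\,p_{n-1}^{**}(a;\eta)}.$$ Then $N_0>0$ and $$x_{n,n}^N<\eta\ \text{ for } N<N_0,\qquad x_{n,n}^N=\eta\ \text{ for } N=N_0,\qquad x_{n,n}^N>\eta\ \text{ for } N>N_0.$$
   Context: $\mu$ is a positive Borel measure on $\mathbb R$ whose support $\Sigma$ has infinitely many points, with all moments finite. $C_0(\Sigma)$ is the convex hull of $\Sigma$. $\{p_n(x)\}_{n\ge0}$ is the sequence of monic orthogonal polynomials for $\mu$, with $\|p\|_\mu^2=\int p^2d\mu$, and $K_n(x,y)=\sum_{j=0}^n p_j(x)p_j(y)/\|p_j\|_\mu^2$. $\{p_n^{**}(a;x)\}_{n\ge0}$ is the sequence of monic orthogonal polynomials for $(x-a)^2d\mu(x)$. $\{p_n^{N}(a;x)\}_{n\ge0}$ is the sequence of monic orthogonal polynomials for $d\mu+N\delta_a$, with $\delta_a$ the unit point mass at $a$. *)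

(* Defs.v *)
From HB Require Import structures.
From mathcomp Require Import all_boot all_order all_algebra.
From mathcomp Require Import all_classical all_reals all_analysis measurable_realfun.
Set Implicit Arguments.
Unset Strict Implicit.
Unset Printing Implicit Defensive.
Import Order.TTheory GRing.Theory Num.Theory.
Import numFieldNormedType.Exports.
Local Open Scope classical_set_scope.
Local Open Scope ring_scope.

(* A Borel measure on [R] is a measure on [measurableTypeR R], whose
   sigma-algebra is generated by the half-open intervals. *)

Definition msupport (R : realType)
    (mu : {measure set (measurableTypeR R) -> \bar R}) : set R :=
  [set x | forall U : set R, open U -> U x -> (0 < mu U)%E].

Definition convex_hull (R : numDomainType) (V : lmodType R) (A : set V) :
    set V :=
  smallest (@convex_set R V) A.

Definition finite_moments (R : realType)
    (mu : {measure set (measurableTypeR R) -> \bar R}) :=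
  forall k : nat, mu.-integrable [set: R] (fun x : R => (x ^+ k)%:E).

(* [Rintegral] is real-valued, with junk value 0 on infinite integrals; it is
   only used for measures whose moments are all finite. *)
Definition monic_orthogonal (R : realType)
    (mu : {measure set (measurableTypeR R) -> \bar R})
    (p : nat -> {poly R}) :=
  [/\ forall n, p n \is monic,
      forall n, size (p n) = n.+1
    & forall m n, m != n ->
        \int[mu]_(x in [set: R]) ((p m).[x] * (p n).[x]) = 0].

Definition sqnorm (R : realType)
    (mu : {measure set (measurableTypeR R) -> \bar R}) (q : {poly R}) : R :=
  \int[mu]_(x in [set: R]) (q.[x] ^+ 2).

Definition ortho_kernel (R : realType)
    (mu : {measure set (measurableTypeR R) -> \bar R})
    (p : nat -> {poly R}) (n : nat) (x y : R) : R :=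
  \sum_(j < n.+1) (p j).[x] * (p j).[y] / sqnorm mu (p j).

(* The measure (x - a)^2 dmu(x). *)
Definition sq_weighted (R : realType)
    (mu : {measure set (measurableTypeR R) -> \bar R}) (a : R) :
    set (measurableTypeR R) -> \bar R :=
  fun A => (\int[mu]_(x in A) ((x - a) ^+ 2)%:E)%E.

Section sq_weighted_measure.
Context (R : realType).
Variables (mu : {measure set (measurableTypeR R) -> \bar R}) (a : R).

Let sq_weighted0 : sq_weighted mu a set0 = 0%E.
Proof. by rewrite /sq_weighted integral_set0. Qed.

Let sq_weighted_ge0 A : (0 <= sq_weighted mu a A)%E.
Proof. by apply: integral_ge0 => x _; rewrite lee_fin sqr_ge0. Qed.

Let sq_weighted_sigma_additive : semi_sigma_additive (sq_weighted mu a).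
Proof.
apply: semi_sigma_additive_nng_induced => [|x]; last first.
  by rewrite lee_fin sqr_ge0.
apply/measurable_EFinP; apply: measurable_funX.
exact: measurable_funB.
Qed.

HB.instance Definition _ := isMeasure.Build _ _ _ (sq_weighted mu a)
  sq_weighted0 sq_weighted_ge0 sq_weighted_sigma_additive.

End sq_weighted_measure.

Definition add_mass (R : realType)
    (mu : {measure set (measurableTypeR R) -> \bar R}) (N : {nonneg R})
    (a : R) : {measure set (measurableTypeR R) -> \bar R} :=
  measure_add mu (mscale N (dirac (a : measurableTypeR R))).

Definition is_largest_zero (R : realType) (q : {poly R}) (x : R) :=
  root q x /\ forall y, root q y -> y <= x.

(* The largest real zero of [q]; junk value 0 if [q] has none. *)
Definition largest_zero (R : realType) (q : {poly R}) : R :=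
  xget 0 [set x | is_largest_zero q x].

(* Main.v *)
Require Import Defs.
From HB Require Import structures.
From mathcomp Require Import all_boot all_order all_algebra.
From mathcomp Require Import all_classical all_reals all_analysis measurable_realfun.
From mathcomp Require Import ring lra.
From mathcomp Require finmap polyrcf.
Set Implicit Arguments.
Unset Strict Implicit.
Unset Printing Implicit Defensive.
Import Order.TTheory GRing.Theory Num.Theory.
Import numFieldNormedType.Exports.
Local Open Scope classical_set_scope.
Local Open Scope ring_scope.

(** Integration against mu is a linear functional L on polynomials.  All that
    the argument uses about mu is that L q > 0 for every nonzero q that is
    nonnegative on ]-oo, eta] ([moment_functional_positive]): mu does not
    charge the complement of its support, and the support is infinite, so q is
    positive at one of its points.  The measures (x - a)^2 dmu and
    mu + N delta_a induce the functionals L ((X - a)^2 q) and L q + N q(a).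

    Adding the mass changes p_n explicitly: with s = p**_(n-1) and
    K = K_(n-1)(a, a), the polynomial p_n + N K (X - a) s is orthogonal to all
    lower degrees for L q + N q(a)
    ([perturbed_orthogonal_expansion]), hence equals (1 + N K) p_n^N by
    uniqueness ([perturbed_orthogonal_unique]).  Evaluating at eta,
      (1 + N K) p_n^N(eta) = p_n(eta) - N K (a - eta) s(eta),
    and since p_n(eta) and s(eta) are positive ([orthogonal_monic_gt0]), the
    sign of p_n^N(eta) is the sign of N0 - N.

    It remains to see that this sign locates the largest zero
    ([largest_zero_sign]).  If p_n^N(eta) < 0, there is a zero beyond eta
    because p_n^N is monic.  If p_n^N(eta) >= 0 and there were a zero y > eta,
    then the cofactor of X - y would be nonpositive at eta, so there would be a
    second zero z >= eta; but p_n^N = (X - y)(X - z) t is then orthogonal to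
    (X - a) t, a polynomial that does not see the mass at a, whereas
    (y - x)(z - x)(a - x) t(x)^2 >= 0 on ]-oo, eta].  And p_n^N has at least one
    real zero, since a positive polynomial is not orthogonal to 1. *)

(** * Real polynomials *)

Lemma monic_root_ge (R : rcfType) (p : {poly R}) (b : R) :
  p \is monic -> p.[b] <= 0 -> exists2 y, b <= y & root p y.
Proof.
move=> /monicP lp pb.
have [|M pM] := @polyrcf.poly_pinfty_gt_lc _ p; first by rewrite lp.
have [||y /andP[] ] := @poly_ivt _ p b (Num.max b M).
- by rewrite le_max lexx.
- by rewrite pb (le_trans ler01)// -{1}lp pM// le_max lexx orbT.
by move=> by_ _ ry; exists y.
Qed.

Lemma monic_factor (F : fieldType) (q : {poly F}) (y : F) :
  q \is monic -> root q y -> exists2 s, s \is monic & q = ('X - y%:P) * s.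
Proof.
move=> qm /factor_theorem[s qE]; exists s; last by rewrite mulrC.
by move: qm; rewrite qE monicMr// monicXsubC.
Qed.

Lemma size_XsubCM (F : fieldType) (s : {poly F}) (y : F) :
  s != 0 -> size (('X - y%:P) * s) = (size s).+1.
Proof. by move=> s0; rewrite size_monicM ?monicXsubC// size_XsubC. Qed.

Lemma ex_largest_zero (R : realType) (q : {poly R}) (y : R) :
  q != 0 -> root q y -> exists x, is_largest_zero q x.
Proof.
move: {2}(size q) (leqnn (size q)) => n.
elim: n q y => [|n IH] q y; first by rewrite leqn0 size_poly_eq0 => ->.
move=> sq q0 /factor_theorem[s qE].
have s0 : s != 0 by apply: contraNneq q0 => s0; rewrite qE s0 mul0r.
have rq z : root q z = root s z || (z == y).
  by rewrite qE rootM root_XsubC.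
have ss : (size s <= n)%N by move: sq; rewrite qE mulrC size_XsubCM.
have [[z rz]|nz] := pselect (exists z, root s z).
  have [x [rx xP]] := IH _ _ ss s0 rz.
  exists (Num.max x y); split.
    by rewrite rq; case: ltP; rewrite ?rx// eqxx orbT.
  by move=> t; rewrite rq le_max => /orP[/xP ->//|/eqP ->]; rewrite lexx orbT.
exists y; split; first by rewrite rq eqxx orbT.
by move=> t; rewrite rq => /orP[rt|/eqP ->//]; case: nz; exists t.
Qed.

Lemma largest_zeroP (R : realType) (q : {poly R}) (y : R) :
  q != 0 -> root q y -> is_largest_zero q (largest_zero q).
Proof. by move=> q0 /(ex_largest_zero q0)[x qx]; exact: (xgetI _ qx). Qed.

Lemma graded_span (F : fieldType) (p : nat -> {poly F}) (n : nat)
    (r : {poly F}) :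
  (forall j, size (p j) = j.+1) -> (size r <= n)%N ->
  exists c : nat -> F, r = \sum_(j < n) c j *: p j.
Proof.
move=> sp; elim: n r => [|n IH] r.
  rewrite leqn0 size_poly_eq0 => /eqP ->.
  by exists (fun=> 0); rewrite big_ord0.
move=> sr.
have lp : (p n)`_n != 0.
  have -> : (p n)`_n = lead_coef (p n) by rewrite /lead_coef sp.
  by rewrite lead_coef_eq0 -size_poly_eq0 sp.
pose k := r`_n / (p n)`_n.
have [|c rE] := IH (r - k *: p n).
  apply/leq_sizeP => j; rewrite leq_eqVlt => /orP[/eqP <-|nj].
    by rewrite coefB coefZ /k divfK// subrr.
  by rewrite coefB coefZ !nth_default ?mulr0 ?subrr ?sp// (leq_trans sr).
exists (fun j => if j == n then k else c j).
rewrite big_ord_recr/= eqxx -[LHS](subrK (k *: p n)) rE; congr (_ + _).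
by apply: eq_bigr => i _; rewrite ltn_eqF.
Qed.

(** * Orthogonality for a positive functional *)

Definition orthogonal_below {R : realType} (L : {poly R} -> R) (n : nat)
    (q : {poly R}) :=
  forall r : {poly R}, (size r <= n)%N -> L (q * r) = 0.

(** The hypothesis on [q] concerns only [x <= b], which is enough for a measure
    carried by ]-oo, b]; factors [y - x] with [b <= y] are then admissible
    weights. *)
Definition positive_left {R : realType} (L : {poly R} -> R) (b : R) :=
  forall q : {poly R}, q != 0 -> (forall x, x <= b -> 0 <= q.[x]) -> 0 < L q.

Section functional.
Context {R : realType} (L : {scalar {poly R}}).

Lemma orthogonal_family_below (p : nat -> {poly R}) (n : nat) :
  (forall j, size (p j) = j.+1) ->
  (forall i j, i != j -> L (p i * p j) = 0) -> orthogonal_below L n (p n).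
Proof.
move=> sp op r /(graded_span sp)[c ->].
rewrite mulr_sumr linear_sum big1// => j _.
by rewrite -scalerAr linearZ/= op ?mulr0// gtn_eqF.
Qed.

(** Otherwise [q] has a root [y >= b]; then [q = (X - y) s] would be orthogonal
    to [s], although [(y - x) s(x)^2] is nonnegative for [x <= b]. *)
Lemma orthogonal_monic_gt0 (b : R) (n : nat) (q : {poly R}) :
  positive_left L b -> q \is monic -> size q = n.+1 ->
  orthogonal_below L n q -> 0 < q.[b].
Proof.
move=> Lpos qm sq oq; rewrite ltNge; apply/negP => qb.
have [y yb ry] := monic_root_ge qm qb.
have [s sm qE] := monic_factor qm ry.
have ss : (size s <= n)%N.
  by move: sq; rewrite qE size_XsubCM ?monic_neq0// => -[<-].
suff : 0 < L (- (q * s)) by rewrite linearN/= oq// oppr0 ltxx.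
apply: Lpos; first by rewrite oppr_eq0 mulf_neq0// monic_neq0.
move=> x xb; rewrite hornerN qE !hornerE.
by rewrite -mulrA -mulNr mulr_ge0// ?sqr_ge0// oppr_ge0 subr_le0 (le_trans xb).
Qed.

(** The Christoffel-Darboux kernel [K_(n-1)(x, a)] as a polynomial in [x]. *)
Definition kernel_poly (p : nat -> {poly R}) (n : nat) (a : R) : {poly R} :=
  \sum_(j < n) ((p j).[a] / L (p j * p j)) *: p j.

Lemma size_kernel_poly (p : nat -> {poly R}) (n : nat) (a : R) :
  (forall j, size (p j) = j.+1) -> (size (kernel_poly p n a) <= n)%N.
Proof.
move=> sp; apply: (leq_trans (size_sum _ _ _)); apply/bigmax_leqP => j _.
by rewrite (leq_trans (size_scale_leq _ _))// sp.
Qed.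

Lemma kernel_reproducing (p : nat -> {poly R}) (n : nat) (a : R)
    (r : {poly R}) :
  (forall j, size (p j) = j.+1) ->
  (forall i j, i != j -> L (p i * p j) = 0) ->
  (forall j, L (p j * p j) != 0) -> (size r <= n)%N ->
  L (kernel_poly p n a * r) = r.[a].
Proof.
move=> sp op hp /(graded_span sp)[c ->].
rewrite mulr_sumr linear_sum horner_sum; apply: eq_bigr => j _.
rewrite -scalerAr linearZ/= hornerZ mulr_suml linear_sum/= (bigD1 j)//=.
rewrite big1 ?addr0; first by rewrite -scalerAl linearZ/= divfK.
by move=> i ij; rewrite -scalerAl linearZ/= (op i j) ?mulr0.
Qed.

Lemma kernel_poly_gt0 (p : nat -> {poly R}) (n : nat) (a : R) :
  (forall j, size (p j) = j.+1) -> (forall j, 0 < L (p j * p j)) ->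
  0 < (kernel_poly p n.+1 a).[a].
Proof.
move=> sp hp; rewrite /kernel_poly horner_sum big_ord_recl /=.
have [c c0 p0E] : exists2 c : R, c != 0 & p 0%N = c%:P.
  by apply/size_poly1P; rewrite sp.
have hE j : (((p j).[a] / L (p j * p j)) *: p j).[a] =
    (p j).[a] ^+ 2 / L (p j * p j) by rewrite hornerZ mulrAC expr2.
rewrite ltr_pwDl ?sumr_ge0// => [|j _].
  by rewrite hE divr_gt0// p0E hornerC exprn_even_gt0.
by rewrite hE divr_ge0 ?sqr_ge0// ltW.
Qed.

Lemma poly_taylor1 (r : {poly R}) (a : R) (m : nat) : (size r <= m.+1)%N ->
  exists2 t : {poly R}, (size t <= m)%N & r = r.[a]%:P + ('X - a%:P) * t.
Proof.
move=> sr; have /factor_theorem[t tE] : root (r - r.[a]%:P) a.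
  by rewrite /root !hornerE subrr.
exists t; last by rewrite mulrC -tE addrC subrK.
have [->|t0] := eqVneq t 0; first by rewrite size_poly0.
have : size (r - r.[a]%:P) = (size t).+1.
  by rewrite tE mulrC size_XsubCM.
rewrite -ltnS => <-.
rewrite (leq_trans (size_polyD _ _))// geq_max sr size_polyN.
by rewrite (leq_trans (size_polyC_leq1 _)).
Qed.

Section mass.
Variables (a b N : R).
Hypotheses (Lpos : positive_left L b) (ba : b < a) (N0 : 0 <= N).
Let M (q : {poly R}) := L q + N * q.[a].

(** The difference [d] of the two sides has degree less than [n], so it is
    orthogonal to itself; but [M (d * d) >= L (d * d)]. *)
Lemma perturbed_orthogonal_unique (n : nat) (q1 q2 : {poly R}) :
  q1 \is monic -> size q1 = n.+1 -> orthogonal_below M n q1 ->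
  (size q2 <= n.+1)%N -> orthogonal_below M n q2 ->
  q2 = q2`_n *: q1.
Proof.
move=> m1 s1 o1 s2 o2; apply/eqP; rewrite -subr_eq0; apply/eqP.
set c := q2`_n; set d := _ - _; have sd : (size d <= n)%N.
  apply/leq_sizeP => j; rewrite leq_eqVlt => /orP[/eqP <-|nj].
    move/monicP: m1; rewrite /lead_coef s1/= coefB coefZ => ->.
    by rewrite mulr1 subrr.
  by rewrite coefB coefZ !nth_default ?mulr0 ?subrr ?s1// (leq_trans s2).
apply: contraTeq isT => d0.
have : M (d * d) = 0.
  rewrite {1}/d mulrBl -scalerAl /M linearB linearZ/=.
  rewrite hornerD hornerN hornerZ !hornerM.
  have := o1 _ sd; have := o2 _ sd; rewrite /M !hornerM => o2d o1d.
  transitivity (L (q2 * d) + N * (q2.[a] * d.[a])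
    - c * (L (q1 * d) + N * (q1.[a] * d.[a]))); first by ring.
  by rewrite o1d o2d mulr0 subr0.
suff : 0 < M (d * d) by move=> /[swap] ->; rewrite ltxx.
rewrite ltr_wpDr ?mulr_ge0 ?hornerM ?sqr_ge0//; apply: Lpos.
  by rewrite mulf_neq0.
by move=> x _; rewrite hornerM sqr_ge0.
Qed.

(** If [q(b) >= 0], a root [y > b] makes the cofactor of [X - y] nonpositive at
    [b], so that this cofactor vanishes at some [z >= b].  Testing against
    [(X - a) t], where [q = (X - y) (X - z) t], removes the point mass and
    leaves the weight [(y - x) (z - x) (a - x)], nonnegative for [x <= b]. *)
Lemma no_root_right (n : nat) (q : {poly R}) (y : R) :
  q \is monic -> size q = n.+1 -> orthogonal_below M n q ->
  0 <= q.[b] -> root q y -> y <= b.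
Proof.
move=> qm sq oq qb ry; rewrite leNgt; apply/negP => by_.
have [s sm qE] := monic_factor qm ry.
have sb : s.[b] <= 0.
  by move: qb; rewrite qE !hornerE nmulr_rge0// subr_lt0.
have [z bz rz] := monic_root_ge sm sb.
have [t tm sE] := monic_factor sm rz.
have st : (size (('X - a%:P) * t)%R <= n)%N.
  move: sq; rewrite qE sE !size_XsubCM ?mulf_neq0 ?polyXsubC_eq0 ?monic_neq0//.
  by move=> [<-].
have := oq _ st; rewrite /M !hornerM hornerXsubC subrr mul0r !mulr0 addr0.
suff : 0 < L (- (q * (('X - a%:P) * t))).
  by rewrite linearN/= => /[swap] ->; rewrite oppr0 ltxx.
apply: Lpos.
  by rewrite oppr_eq0 !mulf_neq0 ?polyXsubC_eq0 ?monic_neq0.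
move=> x xb; rewrite hornerN qE sE !hornerM !hornerXsubC.
rewrite (_ : - _ = ((y - x) * (z - x)) * ((a - x) * (t.[x] * t.[x]))).
  have [xy xz xa] : [/\ x <= y, x <= z & x <= a].
    by split; apply: (le_trans xb) => //; exact: ltW.
  by do 2 apply: mulr_ge0; rewrite ?subr_ge0// -expr2 sqr_ge0.
by ring.
Qed.

(** A monic polynomial without real root is positive everywhere, hence not
    orthogonal to [1]. *)
Lemma perturbed_has_root (n : nat) (q : {poly R}) :
  q \is monic -> (0 < n)%N -> orthogonal_below M n q -> exists y, root q y.
Proof.
move=> qm n0 oq; apply: contrapT => nr.
have qpos x : 0 < q.[x].
  rewrite ltNge; apply/negP => qx.
  by have [y _ ry] := monic_root_ge qm qx; apply: nr; exists y.
have /(oq 1) : (size (1 : {poly R})%R <= n)%N by rewrite size_poly1.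
rewrite mulr1; suff : 0 < M q by move=> /[swap] ->; rewrite ltxx.
rewrite /M ltr_wpDr ?mulr_ge0// ?ltW//; apply: Lpos.
  exact: monic_neq0.
by move=> x _; exact: ltW.
Qed.

Lemma largest_zero_sign (n : nat) (q : {poly R}) :
  q \is monic -> size q = n.+1 -> (0 < n)%N -> orthogonal_below M n q ->
  [/\ 0 < q.[b] -> largest_zero q < b, q.[b] = 0 -> largest_zero q = b
    & q.[b] < 0 -> b < largest_zero q].
Proof.
move=> qm sq n0 oq; have [y ry] := perturbed_has_root qm n0 oq.
have [rl lP] := largest_zeroP (monic_neq0 qm) ry.
split=> [qb|qb|qb].
- rewrite lt_neqAle (no_root_right qm sq oq (ltW qb) rl) andbT.
  by apply: contraTneq rl => ->; rewrite /root gt_eqF.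
- apply/eqP; rewrite eq_le lP ?andbT; last exact/eqP.
  by rewrite (no_root_right qm sq oq _ rl)// qb.
- have [z bz rz] := monic_root_ge qm (ltW qb).
  apply: lt_le_trans (lP _ rz); rewrite lt_neqAle bz andbT.
  by apply: contraTneq rz => <-; rewrite /root lt_eqF.
Qed.

End mass.

(** Every [r] of degree at most [m] is [r(a) + (X - a) t], so by the
    orthogonality of [s] the values [L (w r)], for [w = (X - a) s], are all
    determined by [L w]: [L (w r) = r(a) L w].  Taking for [r] the reproducing
    kernel gives [K L w = - p_(m+1)(a)], which is exactly what cancels the
    contribution of the point mass, because [w(a) = 0]. *)
Lemma perturbed_orthogonal_expansion (p : nat -> {poly R}) (s : {poly R})
    (a N : R) (m : nat) :
  (forall j, p j \is monic) -> (forall j, size (p j) = j.+1) ->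
  (forall i j, i != j -> L (p i * p j) = 0) ->
  (forall j, L (p j * p j) != 0) ->
  s \is monic -> size s = m.+1 ->
  orthogonal_below (fun q => L (('X - a%:P) ^+ 2 * q)) m s ->
  orthogonal_below (fun q => L q + N * q.[a]) m.+1
    (p m.+1 + (N * (kernel_poly p m.+1 a).[a]) *: (('X - a%:P) * s)).
Proof.
move=> mp sp op hp sm ss os.
set k := kernel_poly _ _ _; set w : {poly R} := ('X - a%:P) * s.
have wm : w \is monic by rewrite monicMr// monicXsubC.
have sw : size w = m.+2.
  by rewrite /w size_XsubCM ?monic_neq0// ss.
have kp : L (k * p m.+1) = 0.
  rewrite mulrC; apply: orthogonal_family_below => //.
  exact: size_kernel_poly.
have sd : (size (w - p m.+1)%R <= m.+1)%N.
  apply/leq_sizeP => j; rewrite leq_eqVlt => /orP[/eqP <-|nj].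
    move/monicP: wm; have /monicP := mp m.+1.
    by rewrite /lead_coef sp sw/= coefB => -> ->; rewrite subrr.
  by rewrite coefB !nth_default ?subrr ?sp ?sw.
have wE (r : {poly R}) : (size r <= m.+1)%N -> L (w * r) = r.[a] * L w.
  move=> /(@poly_taylor1 _ a)[t st {1}->].
  rewrite mulrDr linearD/= mulrC mul_polyC linearZ/= /w.
  have -> : ('X - a%:P) * s * (('X - a%:P) * t) = ('X - a%:P) ^+ 2 * (s * t).
    by ring.
  by rewrite os// addr0.
have main : k.[a] * L w = - (p m.+1).[a].
  rewrite -wE ?size_kernel_poly// mulrC.
  (* [w] and [p m.+1] are monic of the same degree, and [L (k * p m.+1) = 0]. *)
  rewrite -[w](subrK (p m.+1)) mulrDr linearD/= kp addr0.
  by rewrite kernel_reproducing// !hornerE subrr mul0r sub0r.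
move=> r sr; rewrite mulrDl linearD/= (orthogonal_family_below sp op sr) add0r.
rewrite -scalerAl linearZ/= wE// hornerD hornerZ !hornerM.
rewrite hornerXsubC subrr mul0r mul0r !mulr0 addr0.
rewrite -(opprK (p m.+1).[a]) -main; ring.
Qed.

End functional.

(** * The moment functional of a measure *)

Lemma measurable_horner {R : realType} (q : {poly R})
    (A : set (measurableTypeR R)) :
  measurable_fun A (fun x : measurableTypeR R => q.[x] : measurableTypeR R).
Proof.
apply/measurable_funTS; apply: continuous_measurable_fun.
exact/continuous_horner.
Qed.

Lemma measurable_EFin_horner {R : realType} (q : {poly R})
    (A : set (measurableTypeR R)) :
  measurable_fun A (fun x : measurableTypeR R => q.[x]%:E).
Proof. by apply/measurable_EFinP; exact: measurable_horner. Qed.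

Section support.
Context {R : realType} (mu : {measure set (measurableTypeR R) -> \bar R}).

(** Every point outside the support lies in a null ball with rational centre and
    radius, and there are countably many of these. *)
Lemma msupport_negligible : mu.-negligible (~` msupport mu).
Proof.
pose F (c : rat * rat) : set (measurableTypeR R) :=
  let B := ball (ratr c.1 : R) (ratr c.2) in if mu B == 0%E then B else set0.
pose G (n : nat) : set (measurableTypeR R) :=
  if unpickle n is Some c then F c else set0.
apply: (@negligibleS _ _ _ mu (\bigcup_n G n)); last first.
  apply: negligible_bigcup => n; rewrite /G.
  case: unpickle => [c|]; last exact: negligible_set0.
  rewrite /F; case: ifPn => [/eqP B0|_]; last exact: negligible_set0.
  exists (ball (ratr c.1 : R) (ratr c.2)); split => //.
  exact: measurable_ball.
move=> x /existsNP[U /not_implyP[oU /not_implyP[Ux /negP]]].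
rewrite -leNgt => U0.
have [c [r [/set_mem xB BU]]] := open_subball_rat oU (mem_set Ux).
have GE : G (pickle (c, r)) = F (c, r) by rewrite /G pickleK.
exists (pickle (c, r)); first exact: I.
rewrite GE /F ifT//.
rewrite eq_le measure_ge0 andbT (le_trans _ U0)// le_measure ?inE//.
- exact: measurable_ball.
- exact: open_measurable.
Qed.

Hypothesis mom : finite_moments mu.

Lemma integrable_horner (q : {poly R}) :
  mu.-integrable [set: R] (fun x : R => q.[x]%:E).
Proof.
under eq_fun do rewrite horner_coef.
under eq_fun do rewrite -sumEFin.
apply: integrable_sum => // i _.
under eq_fun do rewrite EFinM.
by apply: integrableZl => //; exact: mom.
Qed.

(** The proof that the moments are finite is an argument so that linearity,
    which depends on it, can be a canonical structure. *)
Definition moment_functional of finite_moments mu := fun q : {poly R} =>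
  \int[mu]_(x in [set: R]) q.[x].

Fact moment_functional_linear : linear_for *%R (moment_functional mom).
Proof.
move=> c u v; rewrite /moment_functional.
under eq_Rintegral do rewrite hornerD hornerZ.
rewrite RintegralD//; first rewrite RintegralZl//.
- exact: integrable_horner.
- under eq_fun do rewrite -hornerZ.
  exact: integrable_horner.
- exact: integrable_horner.
Qed.

HB.instance Definition _ := GRing.isLinear.Build R {poly R} R *%R
  (moment_functional mom) moment_functional_linear.

(** An infinite support contains a point [x] where [q] does not vanish; near
    [x], [q] exceeds [q(x) / 2] on an open set, which has positive measure. *)
Lemma moment_functional_positive (b : R) :
  infinite_set (msupport mu) -> (forall x, msupport mu x -> x <= b) ->
  positive_left (moment_functional mom) b.
Proof.
move=> supp_inf suppb q q0 qge0.
have [x xs qx] : exists2 x, msupport mu x & q.[x] != 0.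
  apply: contrapT => nx.
  have [B Bs] := infinite_set_fset (size q) supp_inf.
  rewrite leqNgt => /negP; apply.
  apply: max_poly_roots q0 _ (finmap.fset_uniq B).
  apply/allP => y yB; apply: contrapT => /negP ry; apply: nx.
  by exists y => //; exact: Bs.
have qx0 : 0 < q.[x] by rewrite lt_neqAle eq_sym qx qge0 ?suppb.
pose U : set R := [set y | q.[x] / 2 < q.[y]].
have oU : open U.
  apply: (@open_comp _ _ (horner q) [set z | q.[x] / 2 < z]) => [y _|].
    exact: continuous_horner.
  exact: open_gt.
have U0 : (0 < mu U)%E.
  by apply: xs => //; rewrite /U/= ltr_pdivrMr// ltr_pMr// ltr1n.
have mU : measurable (U : set (measurableTypeR R)) by exact: open_measurable.
rewrite /moment_functional /Rintegral fine_gt0//; apply/andP; split; last first.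
  have /integrable_fin_num := integrable_horner q.
  by move=> /(_ measurableT); rewrite ltey_eq => ->.
(* [q] may be negative off the support; replacing it by its positive part makes
   the pointwise comparison with an indicator function valid everywhere. *)
have -> : (\int[mu]_(y in [set: R]) q.[y]%:E =
           \int[mu]_(y in [set: R]) (Num.max q.[y] 0)%:E)%E.
  apply: ae_eq_integral => //.
  - exact: measurable_EFin_horner.
  - apply/measurable_EFinP; apply: measurable_maxr; last exact: measurable_cst.
    exact: measurable_horner.
  - apply: negligibleS msupport_negligible => y /= qy ys; apply: qy => _.
    by rewrite max_l// qge0// suppb.
apply: (@lt_le_trans _ _ ((q.[x] / 2)%:E * mu U)%E).
  by rewrite mule_gt0// lte_fin divr_gt0.
have -> : ((q.[x] / 2)%:E * mu U =
           \int[mu]_(y in [set: R]) (q.[x] / 2 * \1_U y)%:E)%E.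
  under eq_integral do rewrite EFinM.
  rewrite ge0_integralZl// ?lee_fin ?divr_ge0 ?ltW//.
    by rewrite integral_indic// setIT.
  exact/measurable_EFinP.
apply: ge0_le_integral => //.
- by move=> y _; rewrite lee_fin mulr_ge0// divr_ge0// ltW.
- apply/measurable_EFinP; apply: measurable_funM => //.
- apply/measurable_EFinP; apply: measurable_maxr; last exact: measurable_cst.
  exact: measurable_horner.
- move=> y _; rewrite lee_fin indicE; have [/set_mem yU|yU] := boolP (y \in U).
    by rewrite mulr1 le_max (ltW yU).
  by rewrite mulr0 le_max lexx orbT.
Qed.

End support.

(** * Integration for the two modified measures *)

Section density.
Local Open Scope ereal_scope.
Context {d} {T : measurableType d} {R : realType}.
Variables (mu nu : {measure set T -> \bar R}) (g : T -> R).
Hypothesis g0 : forall x, (0 <= g x)%R.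
Hypothesis mg : measurable_fun [set: T] g.
Hypothesis nuE : forall A, measurable A -> nu A = \int[mu]_(x in A) (g x)%:E.

Import HBNNSimple.

Let mgE : measurable_fun [set: T] (EFin \o g).
Proof. exact/measurable_EFinP. Qed.

Let ge0_integral_density_nnsfun (h : {nnsfun T >-> R}) :
  \int[nu]_x (h x)%:E = \int[mu]_x ((h x)%:E * (g x)%:E).
Proof.
have mh r : measurable_fun [set: T] (fun x => (r * \1_(h @^-1` [set r]) x)%:E).
  by apply/measurable_EFinP; exact: measurable_funM.
under eq_integral do rewrite fimfunE -fsumEFin//.
rewrite ge0_integral_fsum//; last by move=> r x _; exact: nnfun_muleindic_ge0.
under [RHS]eq_integral => x _.
  rewrite fimfunE -fsumEFin// ge0_mule_fsuml; last first.
    by move=> r; exact: nnfun_muleindic_ge0.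
  over.
rewrite ge0_integral_fsum//; last 2 first.
- by move=> r; exact: emeasurable_funM.
- move=> r x _; apply: mule_ge0; first exact: nnfun_muleindic_ge0.
  by rewrite lee_fin.
apply: eq_fsbigr => r _.
under eq_integral do rewrite EFinM.
rewrite integralZl_indic_nnsfun// integral_indic// setIT nuE//.
have [r0|r0] := ltP r 0%R.
  by rewrite preimage_nnfun0// integral_set0 mule0 integral0_eq// => x _;
    rewrite indic0 mulr0 mul0e.
under [RHS]eq_integral do rewrite EFinM -muleA.
rewrite ge0_integralZl//.
- congr *%E; rewrite integral_mkcond; apply: eq_integral => x _.
  by rewrite patchE indicE; case: ifPn; rewrite ?mul1e ?mul0e.
- by apply: emeasurable_funM => //; exact/measurable_EFinP.
- by move=> x _; rewrite mule_ge0 ?lee_fin.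
Qed.

(** The hypothesis [nuE] is the case of indicator functions; linearity extends
    it to simple functions and monotone convergence to all nonnegative ones. *)
Lemma ge0_integral_density (f : T -> \bar R) :
  (forall x, 0 <= f x) -> measurable_fun [set: T] f ->
  \int[nu]_x f x = \int[mu]_x (f x * (g x)%:E).
Proof.
move=> f0 mf; pose h := nnsfun_approx measurableT mf.
have hf x : (EFin \o h^~ x) n @[n --> \oo] --> f x.
  by apply: cvg_nnsfun_approx => // y _; exact: f0.
transitivity (limn (fun n => \int[nu]_x (h n x)%:E)).
  rewrite -monotone_convergence//=.
  - by apply: eq_integral => x _; apply/esym/cvg_lim => //; exact: hf.
  - by move=> n; apply/measurable_EFinP.
  - by move=> n x _; rewrite lee_fin.
  - by move=> x _ m n mn; rewrite lee_fin; exact/lefP/nd_nnsfun_approx.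
under eq_fun do rewrite ge0_integral_density_nnsfun.
rewrite -monotone_convergence//=.
- apply: eq_integral => x _; apply/cvg_lim => //.
  by apply: cvgeZr => //; exact: hf.
- by move=> n; apply: emeasurable_funM => //; apply/measurable_EFinP.
- by move=> n x _; rewrite mule_ge0 ?lee_fin.
- move=> x _ m n mn; rewrite lee_wpmul2r ?lee_fin//.
  exact/lefP/nd_nnsfun_approx.
Qed.

End density.

(** A measure for which the integrals of all squares are given by an additive
    functional [L] has finite moments and integrates every polynomial as [L]
    does, since [q = ((q + 1) / 2)^2 - ((q - 1) / 2)^2].  The modified measures
    are thus handled through integrals of nonnegative functions only. *)
Section squares.
Context {R : realType} (nu : {measure set (measurableTypeR R) -> \bar R}).
Variable L : {poly R} -> R.
Hypothesis LB : forall u v, L (u - v) = L u - L v.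
Hypothesis nuL : forall q : {poly R},
  (\int[nu]_x (q.[x] ^+ 2)%:E = (L (q ^+ 2))%:E)%E.

Let integrable_sqr (q : {poly R}) :
  nu.-integrable [set: R] (fun x : R => (q ^+ 2).[x]%:E).
Proof.
apply/integrableP; split; first exact: measurable_EFin_horner.
under eq_integral do rewrite /= horner_exp ger0_norm ?sqr_ge0//.
by rewrite nuL ltry.
Qed.

Lemma finite_moments_of_squares : finite_moments nu.
Proof.
(* The domination used is [|x^k| <= (x^k)^2 + 1]. *)
move=> k; apply: (@le_integrable _ _ _ nu _ _ _
    (fun x : R => ('X^k ^+ 2).[x]%:E + (1 ^+ 2).[x]%:E)%E) => //.
- by apply/measurable_EFinP; exact: measurable_funX.
- move=> x _; rewrite /= !horner_exp hornerX hornerC lee_fin expr1n.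
  rewrite [leRHS]ger0_norm ?addr_ge0 ?sqr_ge0//.
  by rewrite ler_norml; apply/andP; split; nra.
- by apply: integrableD => //; exact: integrable_sqr.
Qed.

Lemma moment_functional_of_squares (mom : finite_moments nu) (q : {poly R}) :
  moment_functional mom q = L q.
Proof.
have sqE u : moment_functional mom (u ^+ 2) = L (u ^+ 2).
  rewrite /moment_functional /Rintegral.
  by under eq_integral do rewrite horner_exp; rewrite nuL.
have -> : q = (2^-1 *: (q + 1)) ^+ 2 - (2^-1 *: (q - 1)) ^+ 2.
  apply: (@scalerI _ _ (2 ^+ 2)); first by rewrite expf_neq0// pnatr_eq0.
  rewrite scalerBr !exprZn !scalerA -exprMn divff ?pnatr_eq0// expr1n !scale1r.
  by rewrite -natrX scaler_nat; ring.
by rewrite linearB/= LB !sqE.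
Qed.

End squares.

Section modified_measures.
Context {R : realType} (mu : {measure set (measurableTypeR R) -> \bar R}).
Hypothesis mom : finite_moments mu.
Variable a : R.

Lemma integral_sqr_sq_weighted (q : {poly R}) :
  (\int[sq_weighted mu a]_x (q.[x] ^+ 2)%:E =
   (moment_functional mom (('X - a%:P) ^+ 2 * q ^+ 2))%:E)%E.
Proof.
rewrite (@ge0_integral_density _ _ _ mu _ (fun x => (x - a) ^+ 2))//=.
- rewrite /moment_functional /Rintegral fineK; last first.
    exact/integrable_fin_num/integrable_horner.
  apply: eq_integral => x _.
  by rewrite -EFinM hornerM !horner_exp hornerXsubC mulrC.
- by move=> x; exact: sqr_ge0.
- by apply: measurable_funX; exact: measurable_funB.
- by move=> x; rewrite lee_fin sqr_ge0.
- apply/measurable_EFinP; apply: measurable_funX; exact: measurable_horner.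
Qed.

Lemma integral_sqr_add_mass (N : {nonneg R}) (q : {poly R}) :
  (\int[add_mass mu N a]_x (q.[x] ^+ 2)%:E =
   (moment_functional mom (q ^+ 2) + N%:num * (q ^+ 2).[a])%:E)%E.
Proof.
have mq : measurable_fun [set: measurableTypeR R]
    (fun x : measurableTypeR R => (q.[x] ^+ 2)%:E).
  by apply/measurable_EFinP; apply: measurable_funX; exact: measurable_horner.
have q0 (x : R) : [set: R] x -> (0 <= (q.[x] ^+ 2)%:E)%E.
  by rewrite lee_fin sqr_ge0.
rewrite /add_mass ge0_integral_measure_add// ge0_integral_mscale//.
rewrite integral_dirac// diracT mul1e EFinD EFinM horner_exp; congr (_ + _)%E.
rewrite /moment_functional /Rintegral fineK.
  by apply: eq_integral => x _; rewrite horner_exp.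
exact/integrable_fin_num/integrable_horner.
Qed.

Lemma finite_moments_sq_weighted : finite_moments (sq_weighted mu a).
Proof.
exact: (@finite_moments_of_squares _ _
  (fun q => moment_functional mom (('X - a%:P) ^+ 2 * q))
  integral_sqr_sq_weighted).
Qed.

Lemma finite_moments_add_mass (N : {nonneg R}) :
  finite_moments (add_mass mu N a).
Proof.
exact: (@finite_moments_of_squares _ _
  (fun q => moment_functional mom q + N%:num * q.[a])
  (integral_sqr_add_mass N)).
Qed.

Lemma moment_functional_sq_weighted (q : {poly R}) :
  moment_functional finite_moments_sq_weighted q =
  moment_functional mom (('X - a%:P) ^+ 2 * q).
Proof.
apply: (@moment_functional_of_squares _ _
  (fun q => moment_functional mom (('X - a%:P) ^+ 2 * q)) _
  integral_sqr_sq_weighted) => u v.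
by rewrite mulrBr linearB.
Qed.

Lemma moment_functional_add_mass (N : {nonneg R}) (q : {poly R}) :
  moment_functional (finite_moments_add_mass N) q =
  moment_functional mom q + N%:num * q.[a].
Proof.
apply: (@moment_functional_of_squares _ _
  (fun q => moment_functional mom q + N%:num * q.[a]) _
  (integral_sqr_add_mass N)) => u v.
rewrite linearB/= hornerD hornerN; ring.
Qed.

End modified_measures.

Lemma monic_orthogonalP (R : realType)
    (mu : {measure set (measurableTypeR R) -> \bar R})
    (mom : finite_moments mu) (p : nat -> {poly R}) :
  monic_orthogonal mu p ->
  forall n, [/\ p n \is monic, size (p n) = n.+1,
    forall m, m != n -> moment_functional mom (p m * p n) = 0
    & orthogonal_below (moment_functional mom) n (p n)].
Proof.
move=> [mp sp op] n.
have op' i j : i != j -> moment_functional mom (p i * p j) = 0.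
  move=> ij; rewrite -[RHS](op _ _ ij).
  by apply: eq_Rintegral => x _; rewrite hornerM.
split=> // [m|]; first exact: op'.
exact: orthogonal_family_below.
Qed.

(** * The largest zero as a function of the mass *)

Theorem corollary2 (R : realType)
    (mu : {measure set (measurableTypeR R) -> \bar R})
    (supp_inf : infinite_set (msupport mu))
    (mom : finite_moments mu)
    (xi eta a : R)
    (hull : convex_hull (msupport mu : set R^o) = `[xi, eta]%classic)
    (eta_a : eta < a)
    (p pss : nat -> {poly R}) (pN : {nonneg R} -> nat -> {poly R})
    (hp : monic_orthogonal mu p)
    (hpss : monic_orthogonal (sq_weighted mu a) pss)
    (hpN : forall N : {nonneg R}, monic_orthogonal (add_mass mu N a) (pN N))
    (n : nat) (n_ge1 : (1 <= n)%N) :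
  let N0 := - (p n).[eta] /
    (ortho_kernel mu p n.-1 a a * (eta - a) * (pss n.-1).[eta]) in
  0 < N0 /\
  forall N : {nonneg R},
    [/\ N%:num < N0 -> largest_zero (pN N n) < eta,
        N%:num = N0 -> largest_zero (pN N n) = eta
      & N0 < N%:num -> eta < largest_zero (pN N n)].
Proof.
case: n n_ge1 => [//|m] _ /=.
have suppb x : msupport mu x -> x <= eta.
  move=> xs; have : convex_hull (msupport mu : set R^o) x.
    exact: sub_gen_smallest xs.
  by rewrite hull /= in_itv/= => /andP[].
pose L := moment_functional mom.
have Lpos : positive_left L eta by exact: moment_functional_positive.
have Lsqr0 (q : {poly R}) : q != 0 -> 0 < L (q * q).
  move=> q0; apply: Lpos; first by rewrite mulf_neq0.
  by move=> x _; rewrite hornerM -expr2 sqr_ge0.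
pose mom2 := finite_moments_sq_weighted mom a.
have L2pos : positive_left (moment_functional mom2) eta.
  move=> q q0 qge0; rewrite moment_functional_sq_weighted; apply: Lpos.
    by rewrite mulf_neq0// expf_neq0// polyXsubC_eq0.
  by move=> x xe; rewrite hornerM horner_exp mulr_ge0 ?sqr_ge0// qge0.
have hP := monic_orthogonalP mom hp.
have mp j : p j \is monic by case: (hP j).
have sp j : size (p j) = j.+1 by case: (hP j).
have op i j : i != j -> L (p i * p j) = 0 by case: (hP j) => _ _ + _; exact.
have p_eta : 0 < (p m.+1).[eta].
  by case: (hP m.+1) => *; exact: (orthogonal_monic_gt0 Lpos).
have [sm ss _ os] := monic_orthogonalP mom2 hpss m.
have s_eta : 0 < (pss m).[eta] by exact: (orthogonal_monic_gt0 L2pos sm ss os).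
pose K := (kernel_poly L p m.+1 a).[a].
have KE : ortho_kernel mu p m a a = K.
  rewrite /K /kernel_poly horner_sum; apply: eq_bigr => j _.
  rewrite hornerZ mulrAC; congr (_ / _ * _).
  by apply: eq_Rintegral => x _; rewrite hornerM expr2.
have K0 : 0 < K.
  by apply: kernel_poly_gt0 => // j; rewrite Lsqr0 ?monic_neq0.
rewrite KE; set D := K * (a - eta) * (pss m).[eta].
have D0 : 0 < D by rewrite !mulr_gt0// subr_gt0.
have -> : - (p m.+1).[eta] / (K * (eta - a) * (pss m).[eta]) =
          (p m.+1).[eta] / D.
  have -> : K * (eta - a) * (pss m).[eta] = - D by rewrite /D; ring.
  by rewrite invrN mulrNN.
split=> [|N]; first exact: divr_gt0.
have [qm sq _ oq] :=
  monic_orthogonalP (finite_moments_add_mass mom a N) (hpN N) m.+1.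
have {}oq : orthogonal_below (fun r => L r + N%:num * r.[a]) m.+1 (pN N m.+1).
  by move=> r sr; rewrite -moment_functional_add_mass; exact: oq.
have c0 : 0 < 1 + N%:num * K by rewrite ltr_pwDl ?mulr_ge0 ?(ltW K0).
have qE : p m.+1 + (N%:num * K) *: (('X - a%:P) * pss m) =
          (1 + N%:num * K) *: pN N m.+1.
  have wm : ('X - a%:P) * pss m \is monic by rewrite monicMr// monicXsubC.
  have sw : size (('X - a%:P) * pss m)%R = m.+2.
    by rewrite size_XsubCM ?monic_neq0// ss.
  have <- : (p m.+1 + (N%:num * K) *: (('X - a%:P) * pss m))`_m.+1
            = 1 + N%:num * K.
    have /monicP := mp m.+1; have /monicP := wm.
    by rewrite /lead_coef sw sp/= coefD coefZ => -> ->; rewrite mulr1.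
  apply: (perturbed_orthogonal_unique Lpos (ge0 N) qm sq oq).
    apply: (leq_trans (size_polyD _ _)); rewrite geq_max sp leqnn/=.
    by apply: (leq_trans (size_scale_leq _ _)); rewrite sw.
  apply: perturbed_orthogonal_expansion => // [j|].
    by rewrite gt_eqF// Lsqr0 ?monic_neq0.
  by move=> r sr; have := os r sr; rewrite moment_functional_sq_weighted.
(* As the first factor is positive, this gives the sign of [pN N] at [eta]. *)
have sgE : (1 + N%:num * K) * (pN N m.+1).[eta] = (p m.+1).[eta] - N%:num * D.
  rewrite -hornerZ -qE hornerD hornerZ hornerM hornerXsubC /D; ring.
have [zlt zeq zgt] := largest_zero_sign Lpos eta_a (ge0 N) qm sq isT oq.
split=> NN.
- by apply: zlt; rewrite -(pmulr_rgt0 _ c0) sgE subr_gt0 -ltr_pdivlMr.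
- apply: zeq; apply: (mulfI (lt0r_neq0 c0)).
  by rewrite sgE NN divfK ?gt_eqF// subrr mulr0.
- by apply: zgt; rewrite -(pmulr_rlt0 _ c0) sgE subr_lt0 -ltr_pdivrMr.
Qed.
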